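(* Let $X$ be a real-valued random variable with distribution function $F(x)=\mathbb{P}(X\le x)$, $-\infty<x<\infty$, and let $\{X_n;\ n\ge 1\}$ be a sequence of i.i.d. random variables with common distribution function $F$. Suppose that there exist constants $0<\rho<\infty$ and $-\infty<\tau<\infty$ and a monotone function $h:[0,\infty)\to(0,\infty)$ with $\lim_{x\to\infty}h(x^2)/h(x)=1$ such that $$\mathbb{P}(X>x)\sim\frac{(\log x)^\tau h(x)}{x^\rho}\quad\text{as }x\to\infty.$$ Then, for all $-\infty<x<\infty$, $$\lim_{n\to\infty}\mathbb{P}\left(\log\max_{1\le k\le n}X_k\le\frac{\ln n+\tau\ln\ln n+\ln h(n)-\tau\ln\rho+x}{\rho}\right)=\exp\left(-e^{-x}\right).$$
   Context: Convention: $\log x=\ln(e\vee x)=\ln\max(e,x)$ for all $-\infty<x<\infty$, where $\ln$ is the natural logarithm. The notation $f(x)\sim g(x)$ means $f(x)/g(x)\to1$. *)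

(* Defs.v *)
From HB Require Import structures.
From mathcomp Require Import all_boot all_order all_algebra finmap.
From mathcomp Require Import all_classical all_reals all_analysis.

Set Implicit Arguments.
Unset Strict Implicit.
Unset Printing Implicit Defensive.

Import Order.TTheory GRing.Theory Num.Theory.
Import numFieldNormedType.Exports.

Local Open Scope classical_set_scope.
Local Open Scope ring_scope.

Definition logp {R : realType} (x : R) : R := ln (Num.max (expR 1) x).

Definition asymp_equiv {R : realType} (f g : R -> R) : Prop :=
  f x / g x @[x --> +oo] --> (1 : R).

Definition monotone_on_nonneg {R : realType} (h : R -> R) : Prop :=
  {in `[0, +oo[ &, {homo h : x y / x <= y}} \/
  {in `[0, +oo[ &, {homo h : x y / x <= y >-> y <= x}}.

Definition mutually_independent {d : measure_display} {T : measurableType d}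
    {R : realType} {P : probability T R} {I : choiceType}
    (A : set I) (X : I -> {RV P >-> R}) : Prop :=
  forall (J : {fset I}) (B : I -> set R),
    [set` J] `<=` A -> (forall i, i \in J -> measurable (B i)) ->
    P (\bigcap_(i in [set` J]) (X i @^-1` B i)) =
    (\prod_(i <- J) P (X i @^-1` B i))%E.

Definition identically_distributed {d : measure_display} {T : measurableType d}
    {R : realType} {P : probability T R} {I : choiceType}
    (A : set I) (X : I -> {RV P >-> R}) (F : R -> \bar R) : Prop :=
  forall i, A i -> cdf (X i) = F.

(* The initial value X 1 of the big operator makes this the maximum of
   X 1, ..., X n for every n >= 1; for n = 0 it is the junk value X 1. *)
Definition max_upto {d : measure_display} {T : measurableType d}
    {R : realType} {P : probability T R}
    (X : nat -> {RV P >-> R}) (n : nat) (w : T) : R :=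
  \big[Num.max/X 1%N w]_(1 <= k < n.+1) X k w.

(* Main.v *)
(* On the logarithmic scale put L s = ln (h (e^s)).  The hypothesis on h says that
   L (2 s) - L s tends to 0; as L is monotone, this gives L s / s -> 0, and
   L (v s) - L s -> 0 whenever v s / s has a positive limit.  With s = ln n and
   threshold t s, t s / s -> 1 / rho, so the tail asymptotics give
   n P(X > e^(t s)) -> e^(-x), and the probability in question is
   (1 - P(X > e^(t s)))^n. *)

Require Import Defs.
From HB Require Import structures.
From mathcomp Require Import all_boot all_order all_algebra finmap.
From mathcomp Require Import all_classical all_reals all_analysis.
From mathcomp Require Import ring lra.

Import Order.TTheory GRing.Theory Num.Theory.
Import numFieldNormedType.Exports.

Local Open Scope classical_set_scope.
Local Open Scope ring_scope.

(** * Slow variation of monotone functions, in additive form *)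

(** Each doubling of a large argument adds at most [C], so [L] grows at most logarithmically, while
    monotonicity bounds it from below by a constant. *)
Lemma monotone_cvg0_div (R : realType) (L : R -> R) (C : R) :
  (forall x y : R, 0 < x -> x <= y -> L x <= L y) ->
  (\forall s \near +oo, L (2 * s) - L s <= C) ->
  L s / s @[s --> +oo] --> 0.
Proof.
move=> Lmono LC.
apply/cvgrPdist_le => e e0.
have e20 : 0 < e / 2 by lra.
have [a [a0 aLC]] : exists a, 0 < a /\ forall s, a <= s -> L (2 * s) - L s <= C.
  case: LC => M [_ MLC]; exists (Num.max M 0 + 1); split.
    by rewrite ltr_wpDl// le_max lexx orbT.
  move=> s Ms; apply: MLC; apply: lt_le_trans Ms.
  by rewrite ltr_pwDr// le_max lexx.
pose b := Num.max a (C / (e / 2)).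
have ab : a <= b by rewrite le_max lexx.
have b0 : 0 < b by exact: lt_le_trans ab.
have Cb : C <= b * (e / 2) by rewrite -ler_pdivrMr// le_max lexx orbT.
(* Halving s costs at most C, which is at most (e / 2) * (s / 2) when 2 * b <= s. *)
have Lup k : forall s, b <= s -> s <= 2 ^+ k * b -> L s <= L (2 * b) + (e / 2) * s.
  elim: k => [|k IH] s bs.
    rewrite expr0 mul1r => sb.
    have : L s <= L (2 * b) by apply: Lmono; lra.
    have : 0 <= (e / 2) * s by rewrite mulr_ge0//; lra.
    lra.
  rewrite exprS => sk.
  have [s2b|s2b] := lerP s (2 * b).
    have : L s <= L (2 * b) by apply: Lmono; lra.
    have : 0 <= (e / 2) * s by rewrite mulr_ge0//; lra.
    lra.
  have := IH (s / 2) ltac:(lra) ltac:(lra).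
  have := aLC (s / 2) ltac:(lra).
  rewrite [2 * _]mulrC divfK; last by lra.
  have : b * (e / 2) <= (s / 2) * (e / 2) by rewrite ler_pM2r//; lra.
  lra.
have Lup' s : b <= s -> L s <= L (2 * b) + (e / 2) * s.
  (* The bound does not depend on [k], so any [k] with s / b <= 2^k will do; m < 2^m provides
     one. *)
  move=> bs; apply: (Lup (Num.truncn (s / b)).+1) => //.
  rewrite -ler_pdivrMr//.
  apply: le_trans (ltW (truncnS_gt _)) _.
  by rewrite -natrX ler_nat ltnW// ltn_expl.
near=> s.
have bs : b <= s by near: s; apply: nbhs_pinfty_ge; rewrite num_real.
have s0 : 0 < s by lra.
(* The other half of [e] absorbs the constants. *)
have Ks : (`|L b| + `|L (2 * b)|) <= (e / 2) * s.
  by rewrite [leRHS]mulrC -ler_pdivrMr//; near: s; apply: nbhs_pinfty_ge; rewrite num_real.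
rewrite sub0r normrN normrM normfV (gtr0_norm s0) ler_pdivrMr// ler_norml.
have := Lup' s bs.
have : L b <= L s by exact: Lmono.
have := ler_norm (L (2 * b)).
have := ler_norm (- L b); rewrite normrN.
have := normr_ge0 (L b); have := normr_ge0 (L (2 * b)).
have : 0 <= e * s by rewrite mulr_ge0 ?ltW.
move=> *; apply/andP; split; lra.
Unshelve. all: by end_near. Qed.

(** The difference telescopes into [k] single doublings. *)
Lemma cvg_dilation_pow2 (R : realType) (L : R -> R) (k : nat) :
  L (2 * s) - L s @[s --> +oo] --> 0 ->
  L (2 ^+ k * s) - L s @[s --> +oo] --> 0.
Proof.
move=> L2; elim: k => [|k IH].
  rewrite (_ : (fun s => _) = cst 0); first exact: cvg_cst.
  by apply/funext => s; rewrite expr0 mul1r subrr.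
rewrite (_ : (fun s => _) = ((fun s => L (2 ^+ k * (2 * s)) - L (2 * s)) \+
   (fun s => L (2 * s) - L s))).
  rewrite -[X in _ --> X]addr0; apply: cvgD => //.
  apply: (@cvg_comp _ _ _ (fun s => 2 * s) (fun s => L (2 ^+ k * s) - L s) _ _ _ _ IH).
  by apply: gt0_cvgMry => //; exact: cvg_id.
by apply/funext => s /=; rewrite exprSr -mulrA; lra.
Qed.

(** In multiplicative terms e^L is slowly varying: the dilation factor 2 is given, and monotonicity
    supplies all the others. *)
Lemma slowly_varying_cvg (R : realType) (T : Type) (F : set_system T)
    {FF : Filter F} (L : R -> R) (u v : T -> R) (c : R) :
  (forall x y : R, 0 < x -> x <= y -> L x <= L y) ->
  L (2 * s) - L s @[s --> +oo] --> 0 ->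
  u n @[n --> F] --> +oo -> v n / u n @[n --> F] --> c -> 0 < c ->
  L (v n) - L (u n) @[n --> F] --> 0.
Proof.
move=> Lmono L2 uy vuc c0.
(* Monotonicity traps L (v n) between the values of L at 2^-k u n and 2^k u n. *)
have [k [ck kc]] : exists k, c < 2 ^+ k /\ 2 ^- k < c.
  have lt2 (x : R) : 0 <= x -> x < 2 ^+ (Num.truncn x).+1.
    move=> x0; apply: lt_trans (truncnS_gt _) _.
    by rewrite -natrX ltr_nat ltn_expl.
  exists (maxn (Num.truncn c).+1 (Num.truncn c^-1).+1); split.
    apply: lt_le_trans (lt2 _ (ltW c0)) _.
    by rewrite ler_eXn2l ?ltr1n// leq_maxl.
  rewrite -[X in _ < X]invrK ltf_pV2 ?posrE ?invr_gt0 ?exprn_gt0//.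
  apply: lt_le_trans (lt2 _ _) _; first by rewrite invr_ge0 ltW.
  by rewrite ler_eXn2l ?ltr1n// leq_maxr.
have k0 : (0 : R) < 2 ^+ k by rewrite exprn_gt0.
(* The lower bound is a dilation by 2^k from the base point [2 ^- k * u n], which therefore has to
   tend to infinity as well. *)
have ky : 2 ^- k * u n @[n --> F] --> +oo.
  apply/cvgryPge => A; apply: filterS (cvgry_ge uy (2 ^+ k * A)) => n.
  by rewrite ler_pdivlMl.
have Lk := cvg_dilation_pow2 _ _ k L2.
have Lup : L (2 ^+ k * u n) - L (u n) @[n --> F] --> 0.
  exact: (@cvg_comp _ _ _ u (fun s => L (2 ^+ k * s) - L s) _ _ _ uy Lk).
have Llo : - (L (2 ^+ k * (2 ^- k * u n)) - L (2 ^- k * u n)) @[n --> F] --> 0.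
  by rewrite -[X in _ --> X]oppr0; apply: cvgN;
    exact: (@cvg_comp _ _ _ (fun n => 2 ^- k * u n) (fun s => L (2 ^+ k * s) - L s) _ _ _ ky Lk).
apply: (squeeze_cvgr _ Llo Lup).
near=> n.
have u0 : 0 < u n by near: n; apply: cvgry_gt uy _.
have vu : v n <= 2 ^+ k * u n.
  by rewrite -ler_pdivrMr//; near: n; apply: cvgr_le vuc _ ck.
have uv : 2 ^- k * u n <= v n.
  by rewrite -ler_pdivlMr//; near: n; apply: cvgr_ge vuc _ kc.
have v0 : 0 < v n by apply: lt_le_trans uv; rewrite mulr_gt0 ?invr_gt0.
rewrite mulrA divff ?gt_eqF// mul1r opprB; apply/andP; split.
  by rewrite lerD2r; apply: Lmono => //; rewrite mulr_gt0 ?invr_gt0.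
by rewrite /= lerD2r; apply: Lmono => //; rewrite mulr_gt0.
Unshelve. all: by end_near. Qed.

(** * The Poisson-type limit of (1 - q)^n *)

Lemma cvg_expr_onem (R : realType) (q : nat -> R) (a : R) :
  (forall n, 0 <= q n) -> n%:R * q n @[n --> \oo] --> a ->
  (1 - q n) ^+ n @[n --> \oo] --> expR (- a).
Proof.
move=> q0 nq.
(* As q = (n q) / n, it vanishes in the limit; hence 1 - q is eventually positive and the division
   by it in [lo] does not change the limit. *)
have q_cvg0 : q n @[n --> \oo] --> 0.
  have ninv : (n%:R : R)^-1 @[n --> \oo] --> 0.
    apply/gtr0_cvgV0; last exact: cvgr_idn.
    by near=> n; rewrite ltr0n; near: n; exact: nbhs_infty_gt.
  have := cvgM nq ninv; rewrite mulr0 => nqV.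
  apply: cvg_trans; last exact: nqV.
  apply: near_eq_cvg.
  near=> n => /=; rewrite mulrAC divff ?mul1r// pnatr_eq0 -lt0n.
  by near: n; exact: nbhs_infty_gt.
(* e^(-q / (1 - q)) <= 1 - q <= e^(-q): both are instances of 1 + y <= e^y. *)
have hi : expR (- (n%:R * q n)) @[n --> \oo] --> expR (- a).
  by apply: continuous_cvg; [exact: continuous_expR | exact: cvgN].
have lo : expR (- (n%:R * q n / (1 - q n))) @[n --> \oo] --> expR (- a).
  apply: continuous_cvg; first exact: continuous_expR.
  apply: cvgN; rewrite -[a in _ --> a]divr1; apply: cvgM => //.
  apply: cvgV; first exact: oner_neq0.
  by rewrite -[X in _ --> X]subr0; apply: cvgB => //; exact: cvg_cst.
apply: (squeeze_cvgr _ lo hi).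
near=> n.
have qn1 : q n < 1 by near: n; apply: cvgr_lt q_cvg0 _ ltr01.
have p0 : 0 < 1 - q n by rewrite subr_gt0.
(* Take y = q / (1 - q), for which 1 + y is the inverse of 1 - q. *)
have Hlo : expR (- (q n / (1 - q n))) <= 1 - q n.
  rewrite expRN -[leRHS]invrK lef_pV2 ?posrE ?expR_gt0 ?invr_gt0//.
  apply: le_trans (expR_ge1Dx _).
  rewrite [leLHS](_ : _ = 1 + q n / (1 - q n))//.
  by field; rewrite gt_eqF.
have Hhi : 1 - q n <= expR (- q n) by exact: expR_ge1Dx.
apply/andP; split.
  rewrite -mulrA -mulrN mulrC expRM_natr.
  by rewrite lerXn2r// nnegrE ltW ?expR_gt0.
rewrite -mulrN mulrC expRM_natr.
by rewrite lerXn2r// nnegrE ltW ?expR_gt0.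
Unshelve. all: by end_near. Qed.

(** * Behaviour of [ln], [expR] and [logp] *)

Lemma cvgy_ln (R : realType) : (@ln R) s @[s --> +oo] --> +oo.
Proof.
apply/cvgryPge => A; near=> s.
have As : expR A <= s by near: s; apply: nbhs_pinfty_ge; rewrite num_real.
by rewrite -[A]expRK ler_ln ?posrE ?expR_gt0// (lt_le_trans _ As) ?expR_gt0.
Unshelve. all: by end_near. Qed.

Lemma cvgy_expR (R : realType) : (@expR R) s @[s --> +oo] --> +oo.
Proof.
apply/cvgryPge => A; near=> s.
apply: le_trans (expR_ge1Dx s); rewrite -lerBlDl.
by near: s; apply: nbhs_pinfty_ge; rewrite num_real.
Unshelve. all: by end_near. Qed.

(** The truncation at e is harmless because e <= e^t. *)
Lemma logp_le (R : realType) (m t : R) : 1 <= t ->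
  (logp m <= t) = (m <= expR t).
Proof.
move=> t1; rewrite /logp.
have m0 : 0 < Num.max (expR 1) m by rewrite lt_max expR_gt0.
by rewrite -ler_expR lnK// ge_max ler_expR t1.
Qed.

(** * Distribution of the maximum of i.i.d. variables *)

Lemma max_upto_leP (R : realType) (d : measure_display) (T : measurableType d)
    (P : probability T R) (Xs : nat -> {RV P >-> R}) (n : nat) (w : T) (y : R) :
  (0 < n)%N ->
  max_upto Xs n w <= y <-> (forall i, (1 <= i <= n)%N -> Xs i w <= y).
Proof.
move=> n0; rewrite /max_upto; split=> [maxy i /andP[i1 ni]|Xy].
  apply: le_trans maxy; apply: (le_bigmax_seq _ _ xpredT (Xs^~ w)) => //.
  by rewrite mem_index_iota i1 ltnS.
(* The initial value [Xs 1] is itself one of the terms because [n] is positive. *)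
rewrite big_nat; apply: bigmax_le; first by apply: Xy; rewrite n0.
by move=> i; rewrite ltnS; exact: Xy.
Qed.

(** The event is an intersection of half-line events, one for each index from 1 to [n]: independence
    factors it, and equality of the cdfs makes the factors equal. *)
Lemma probability_max_upto_le (R : realType) (d : measure_display)
    (T : measurableType d) (P : probability T R) (X : {RV P >-> R})
    (Xs : nat -> {RV P >-> R}) (n : nat) (y : R) :
  mutually_independent [set n | (1 <= n)%N] Xs ->
  identically_distributed [set n | (1 <= n)%N] Xs (cdf X) ->
  (0 < n)%N ->
  P [set w | max_upto Xs n w <= y] =
  ((1 - fine (P [set w | y < X w])) ^+ n)%:E.
Proof.
move=> indep ident n0.
pose J := [fset i in index_iota 1 n.+1]%fset.
have Jn i : (i \in J) = (1 <= i <= n)%N by rewrite !inE mem_index_iota ltnS.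
have -> : [set w | max_upto Xs n w <= y] =
    \bigcap_(i in [set` J]) (Xs i @^-1` `]-oo, y]).
  apply/seteqP; split=> w /=.
    move=> /max_upto_leP Xy i /=; rewrite Jn => /Xy; rewrite in_itv/=; exact.
  move=> Xy; apply/max_upto_leP => // i; rewrite -Jn => /Xy.
  by rewrite /= in_itv.
rewrite indep; last 2 first.
- by move=> i /=; rewrite Jn => /andP[].
- by move=> i _; exact: measurable_itv.
have PX i : i \in J -> P (Xs i @^-1` `]-oo, y]) =
    (1 - fine (P [set w | y < X w]))%:E.
  rewrite Jn => /andP[/ident/(congr1 (@^~ y)) cdfE _].
  have -> : P (Xs i @^-1` `]-oo, y]) = P (X @^-1` `]-oo, y]) by exact: cdfE.
  have mX : measurable [set w | y < X w].
    have -> : [set w | y < X w] = X @^-1` `]y, +oo[.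
      by apply/seteqP; split=> w /=; rewrite in_itv/= andbT.
    by rewrite -[X in measurable X]setTI; exact: measurable_funP.
  rewrite EFinB fineK; last exact: fin_num_measure.
  rewrite -probability_setC//; congr (P _).
  by apply/seteqP; split=> w /=; rewrite in_itv/= leNgt => /negP.
rewrite big_seq (eq_bigr (fun=> (1 - fine (P [set w | y < X w]))%:E)); last exact: PX.
rewrite -big_seq big_const_seq count_predT.
have -> : size J = n.
  by rewrite -[LHS]/#|` J|%fset card_fseq undup_id ?iota_uniq// size_iota subSS subn0.
by elim: n {n0 J Jn PX} => //= n ->; rewrite exprS.
Qed.

(** * Regularity of [ln] and of L s = ln (h (e^s)) *)

Lemma cvg_ln_div (R : realType) : (@ln R) s / s @[s --> +oo] --> 0.
Proof.
apply: (@monotone_cvg0_div _ _ (ln 2)) => [x y x0 xy|].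
  by rewrite ler_ln ?posrE// (lt_le_trans x0).
near=> s.
have s0 : 0 < s by near: s; apply: nbhs_pinfty_gt; rewrite num_real.
by rewrite lnM ?posrE// addrK.
Unshelve. all: by end_near. Qed.

(** Under x = e^s, squaring x becomes doubling s. *)
Lemma cvg_ln_slow (R : realType) (h : R -> R) :
  (forall x, 0 <= x -> 0 < h x) ->
  h (x ^+ 2) / h x @[x --> +oo] --> (1 : R) ->
  ln (h (expR (2 * s))) - ln (h (expR s)) @[s --> +oo] --> 0.
Proof.
move=> h0 hs.
have hs' : h (expR s ^+ 2) / h (expR s) @[s --> +oo] --> (1 : R).
  exact: (@cvg_comp _ _ _ expR (fun x => h (x ^+ 2) / h x) _ _ _ (@cvgy_expR R) hs).
have hln : ln (h (expR s ^+ 2) / h (expR s)) @[s --> +oo] --> ln (1 : R).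
  exact: continuous_cvg (continuous_ln ltr01) hs'.
rewrite ln1 in hln; apply: cvg_trans; last exact: hln.
apply: near_eq_cvg; apply: nearW => s.
by rewrite [2 * s]mulrC expRM_natr ln_div ?posrE ?h0 ?exprn_ge0 ?expR_ge0//.
Qed.

Lemma ln_slow_regularity (R : realType) (h : R -> R) (L := fun s => ln (h (expR s))) :
  (forall x, 0 <= x -> 0 < h x) ->
  monotone_on_nonneg h ->
  h (x ^+ 2) / h x @[x --> +oo] --> (1 : R) ->
  L s / s @[s --> +oo] --> 0 /\
  (forall (v : R -> R) (c : R), 0 < c -> v s / s @[s --> +oo] --> c ->
     L (v s) - L s @[s --> +oo] --> 0).
Proof.
move=> h0 hmono hs; have L2 : L (2 * s) - L s @[s --> +oo] --> 0 by exact: cvg_ln_slow.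
have exp_in (s : R) : expR s \in `[0, +oo[ by rewrite in_itv/= expR_ge0.
have bounded (M : R -> R) : M (2 * s) - M s @[s --> +oo] --> 0 ->
    \forall s \near +oo, M (2 * s) - M s <= 1.
  by move=> M2; apply: cvgr_le M2 _ ltr01.
case: hmono => hmono.
  have Lmono (x y : R) : 0 < x -> x <= y -> L x <= L y.
    by move=> _ xy; rewrite ler_ln ?posrE ?h0 ?expR_ge0// hmono ?ler_expR.
  split=> [|v c c0 vc].
    exact: monotone_cvg0_div Lmono (bounded _ L2).
  exact: (slowly_varying_cvg _ _ _ _ id v _ Lmono L2 cvg_id vc c0).
(* For decreasing [h], the same two lemmas apply to [- L], and the sign is removed afterwards. *)
have Lmono (x y : R) : 0 < x -> x <= y -> - L x <= - L y.
  by move=> _ xy; rewrite lerN2 ler_ln ?posrE ?h0 ?expR_ge0// hmono ?ler_expR.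
have NL2 : - L (2 * s) - - L s @[s --> +oo] --> 0.
  rewrite -oppr0; under eq_fun do rewrite -opprD.
  exact: cvgN.
have cvgN0 (f : R -> R) : - f s @[s --> +oo] --> 0 -> f s @[s --> +oo] --> 0.
  move=> /cvgN; rewrite oppr0 => f0; apply: cvg_trans; last exact: f0.
  by apply: near_eq_cvg; apply: nearW => s /=; rewrite opprK.
split=> [|v c c0 vc]; apply: cvgN0.
  have := monotone_cvg0_div _ (fun s => - L s) _ Lmono (bounded _ NL2).
  by under eq_fun do rewrite mulNr.
under eq_fun do rewrite opprD.
exact: (slowly_varying_cvg _ _ _ (fun s => - L s) id v _ Lmono NL2 cvg_id vc c0).
Qed.

(** * The threshold on the logarithmic scale *)

(** Here s stands for ln n and L s for ln (h n). A real variable allows limits at [+oo]; the passage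
    to s = ln n comes only at the end. *)
Definition log_threshold (R : realType) (rho tau x : R) (L : R -> R) (s : R) : R :=
  (s + tau * ln s + L s - tau * ln rho + x) / rho.

Section log_threshold.
Context (R : realType) (rho tau x : R) (L : R -> R).
Hypothesis rho_gt0 : 0 < rho.
Hypothesis L_div : L s / s @[s --> +oo] --> 0.

Let t := log_threshold R rho tau x L.

(** All terms of the numerator other than s are o(s). *)
Lemma cvg_log_threshold_div : t s / s @[s --> +oo] --> rho^-1.
Proof.
have sV : (s : R)^-1 @[s --> +oo] --> 0.
  apply/gtr0_cvgV0; last exact: cvg_id.
  by apply: nbhs_pinfty_gt; rewrite num_real.
have H : (1 + tau * (ln s / s) + L s / s + (x - tau * ln rho) * s^-1) / rho
    @[s --> +oo] --> (1 + tau * 0 + 0 + (x - tau * ln rho) * 0) / rho.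
  apply: cvgMr_tmp; apply: cvgD; last exact: cvgMl_tmp.
  apply: cvgD => //; apply: cvgD; first exact: cvg_cst.
  by apply: cvgMl_tmp; exact: cvg_ln_div.
rewrite !mulr0 !addr0 mul1r in H.
apply: cvg_trans; last exact: H.
apply: near_eq_cvg; near=> s.
have s0 : s != 0.
  by rewrite gt_eqF//; near: s; apply: nbhs_pinfty_gt; rewrite num_real.
by rewrite /t /log_threshold; field; rewrite s0 gt_eqF.
Unshelve. all: by end_near. Qed.

Lemma cvgy_log_threshold : t s @[s --> +oo] --> +oo.
Proof.
(* Half the limit of t s / s is eventually a positive lower bound for it. *)
have r0 : 0 < rho^-1 / 2 by rewrite divr_gt0// invr_gt0.
apply/cvgryPge => A; near=> s.
have s0 : 0 < s by near: s; apply: nbhs_pinfty_gt; rewrite num_real.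
have : rho^-1 / 2 <= t s / s.
  near: s; apply: cvgr_ge cvg_log_threshold_div _ _.
  by rewrite ltr_pdivrMr// ltr_pMr ?invr_gt0// ltr1n.
by rewrite ler_pdivlMr//; apply: le_trans; rewrite mulrC -ler_pdivrMr//.
Unshelve. all: by end_near. Qed.

(** The expression is the logarithm of e^s times the tail equivalent at e^(t s). Expanding rho * t s
    leaves tau * (ln (t s / s) + ln rho) + (L (t s) - L s) - x; the correction - tau * ln rho in the
    threshold offsets the limit - ln rho of ln (t s / s). *)
Lemma cvg_log_threshold_exponent : L (t s) - L s @[s --> +oo] --> 0 ->
  s + tau * ln (t s) + L (t s) - rho * t s @[s --> +oo] --> - x.
Proof.
move=> LtL.
have lnt : ln (t s / s) @[s --> +oo] --> - ln rho.
  rewrite -lnV ?posrE//; apply: continuous_cvg cvg_log_threshold_div.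
  by apply: continuous_ln; rewrite invr_gt0.
have H : tau * (ln (t s / s) + ln rho) + (L (t s) - L s) - x @[s --> +oo] -->
    tau * (- ln rho + ln rho) + 0 - x.
  apply: cvgB; last exact: cvg_cst.
  apply: cvgD => //; apply: cvgMl_tmp.
  by apply: cvgD => //; exact: cvg_cst.
rewrite addNr mulr0 addr0 sub0r in H.
apply: cvg_trans; last exact: H.
apply: near_eq_cvg; near=> s.
have s0 : 0 < s by near: s; apply: nbhs_pinfty_gt; rewrite num_real.
have t0 : 0 < t s by near: s; apply: cvgry_gt cvgy_log_threshold _.
have -> : rho * t s = s + tau * ln s + L s - tau * ln rho + x.
  by rewrite mulrC divfK// gt_eqF.
rewrite ln_div ?posrE//.
lra.
Unshelve. all: by end_near. Qed.

End log_threshold.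

(** * The tail at the threshold *)

Lemma cvg_scaled_tail (R : realType) (rho tau x : R) (h q : R -> R)
    (L := fun s => ln (h (expR s)))
    (t := log_threshold R rho tau x L) :
  0 < rho ->
  (forall x, 0 <= x -> 0 < h x) ->
  monotone_on_nonneg h ->
  h (x ^+ 2) / h x @[x --> +oo] --> (1 : R) ->
  asymp_equiv q (fun x => logp x `^ tau * h x / x `^ rho) ->
  expR s * q (expR (t s)) @[s --> +oo] --> expR (- x).
Proof.
move=> rho0 h0 hmono hs qg.
have [L_div L_slow] := ln_slow_regularity _ _ h0 hmono hs.
have t_div : t s / s @[s --> +oo] --> rho^-1 by exact: cvg_log_threshold_div.
have ty : t s @[s --> +oo] --> +oo by exact: cvgy_log_threshold.
have LtL : L (t s) - L s @[s --> +oo] --> 0.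
  by apply: L_slow t_div; rewrite invr_gt0.
have texp := cvg_log_threshold_exponent _ _ _ x _ rho0 L_div LtL.
pose g y := logp y `^ tau * h y / y `^ rho.
have yy : expR (t s) @[s --> +oo] --> +oo.
  exact: (@cvg_comp _ _ _ t expR _ _ _ ty (@cvgy_expR R)).
have qgy : q (expR (t s)) / g (expR (t s)) @[s --> +oo] --> (1 : R).
  exact: (@cvg_comp _ _ _ (fun s => expR (t s)) (fun y => q y / g y) _ _ _ yy qg).
have H := cvgM qgy (continuous_cvg _ (@continuous_expR R _) texp).
rewrite mul1r in H; apply: cvg_trans; last exact: H.
apply: near_eq_cvg; near=> s => /=.
have t1 : 1 <= t s by near: s; apply: cvgry_ge ty _.
(* Since t s >= 1, [logp] inverts [expR] here; the bases of the powers being nonzero, [powR] is an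
   exponential, and so is [g] as a whole. *)
have gE : g (expR (t s)) = expR (tau * ln (t s) + L (t s) - rho * t s).
  have logpE : logp (expR (t s)) = t s.
    by rewrite /logp max_r ?expRK// ler_expR.
  rewrite /g logpE /powR !gt_eqF ?expR_gt0 ?(lt_le_trans ltr01)// expRK.
  by rewrite expRB expRD [expR (L _)]lnK// posrE h0 ?expR_ge0.
rewrite -/t -!addrA expRD !addrA -gE.
by field; rewrite gE gt_eqF// expR_gt0.
Unshelve. all: by end_near. Qed.

(** * Convergence to the Gumbel law *)

Theorem theorem2p5 (R : realType) (d : measure_display) (T : measurableType d)
  (P : probability T R) (X : {RV P >-> R}) (Xs : nat -> {RV P >-> R})
  (F : R -> \bar R) (rho tau : R) (h : R -> R)
  (hF : F = cdf X)
  (Xs_indep : mutually_independent [set n | (1 <= n)%N] Xs)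
  (Xs_ident : identically_distributed [set n | (1 <= n)%N] Xs F)
  (rho_gt0 : 0 < rho)
  (h_gt0 : forall x, 0 <= x -> 0 < h x)
  (h_mono : monotone_on_nonneg h)
  (h_slow : h (x ^+ 2) / h x @[x --> +oo] --> (1 : R))
  (X_tail : asymp_equiv (fun x => fine (P [set w | x < X w]))
                        (fun x => logp x `^ tau * h x / x `^ rho)) :
  forall x : R,
    P [set w | logp (max_upto Xs n w) <=
               (ln n%:R + tau * ln (ln n%:R) + ln (h n%:R) - tau * ln rho + x)
               / rho]
      @[n --> \oo] --> (expR (- expR (- x)))%:E.
Proof.
move=> x; subst F.
pose q y := fine (P [set w | y < X w]).
pose L s := ln (h (expR s)).
pose y n := expR (log_threshold R rho tau x L (ln (n%:R : R))).
have lny : ln (n%:R : R) @[n --> \oo] --> +oo.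
  exact: (@cvg_comp _ _ _ _ (@ln R) _ _ _ cvgr_idn (@cvgy_ln R)).
have tail := cvg_scaled_tail _ _ _ x _ _ rho_gt0 h_gt0 h_mono h_slow X_tail.
have tail_ln : expR (ln n%:R) * q (y n) @[n --> \oo] --> expR (- x).
  exact: (@cvg_comp _ _ _ (fun n => ln n%:R)
    (fun s => expR s * q (expR (log_threshold R rho tau x L s))) _ _ _ lny tail).
have nq : n%:R * q (y n) @[n --> \oo] --> expR (- x).
  apply: cvg_trans; last exact: tail_ln.
  (* e^(ln n) = n requires n > 0, as [ln 0] is a default value. *)
  apply: near_eq_cvg; near=> n.
  by rewrite lnK// posrE ltr0n; near: n; exact: nbhs_infty_gt.
have q0 n : 0 <= q (y n) by rewrite fine_ge0.
have lim := cvg_expr_onem _ _ _ q0 nq.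
have limE : ((1 - q (y n)) ^+ n)%:E @[n --> \oo] --> (expR (- expR (- x)))%:E.
  by apply: cvg_EFin lim; exact: nearW.
apply: cvg_trans; last exact: limE.
apply: near_eq_cvg; near=> n.
have n0 : (0 < n)%N by near: n; exact: nbhs_infty_gt.
(* This lower bound lets [logp_le] turn the event on [logp] into one on the maximum itself. *)
have t1 : 1 <= log_threshold R rho tau x L (ln n%:R).
  near: n; apply: cvgry_ge.
  apply: (@cvg_comp _ _ _ (fun n => ln n%:R) (log_threshold R rho tau x L) _ _ _ lny).
  by apply: cvgy_log_threshold => //; case: (ln_slow_regularity _ _ h_gt0 h_mono h_slow).
rewrite /= -(probability_max_upto_le _ _ _ _ _ _ _ _ Xs_indep Xs_ident n0).
congr (P _); apply/seteqP; split=> w /=;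
  by rewrite -logp_le// /log_threshold /L lnK ?posrE ?ltr0n.
Unshelve. all: by end_near. Qed.
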